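(* Let $F(z)$ be regular (holomorphic) in a neighborhood of the closed lower half-plane $\{z:\operatorname{Im} z\le 0\}$ and suppose that $F(z)\to0$ as $|z|\to\infty$, uniformly in $-\pi\le\arg z\le 0$. For real $x$ write $F(x)=U(x)+iV(x)$ with $U,V$ real-valued. Then for every real $\xi$ the limit $F^-(\xi)$ of $F(z)$ as $z$ tends to $\xi$ from $\operatorname{Im} z<0$ satisfies $$F^-(\xi)=F(\xi),\qquad F(\xi)=\frac{-1}{\pi i}\,\mathcal{P}\int_{-\infty}^\infty\frac{F(x)\,dx}{x-\xi},$$ and consequently, for all real $\xi$ and $x$ respectively, $$U(\xi)=\frac{-1}{\pi}\,\mathcal{P}\int_{-\infty}^\infty\frac{V(x)\,dx}{x-\xi},\qquad V(x)=\frac{1}{\pi}\,\mathcal{P}\int_{-\infty}^\infty\frac{U(\xi)\,d\xi}{\xi-x}.$$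
   Context: The symbol $\mathcal{P}\int_{-\infty}^\infty \frac{g(x)}{x-\xi}\,dx$ denotes the Cauchy principal value, both at $x=\xi$ and at infinity: the limit as $\epsilon\to0^+$ and $R\to\infty$ of the integral over $\{x\in[-R,R]:|x-\xi|\ge\epsilon\}$. *)

(* Defs.v *)
From Stdlib Require Import Reals.
From Coquelicot Require Import Coquelicot.
Open Scope R_scope.

(** Complex differentiability at every point of [D]; values of [F] off [D] are
    unconstrained when [D] is open. *)
Definition holomorphic_on (D : C -> Prop) (F : C -> C) : Prop :=
  forall z : C, D z -> ex_derive (K := C_AbsRing) (V := C_NormedModule) F z.

(** [F (r e^(i theta)) -> 0] as [r -> +oo], uniformly for [theta] in [[-pi, 0]]. *)
Definition vanishes_at_infinity_lower (F : C -> C) : Prop :=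
  forall eps : R, 0 < eps ->
  exists M : R, forall r theta : R, M < r -> - PI <= theta <= 0 ->
    Cmod (F (r * cos theta, r * sin theta)) < eps.

(** Integrand of the truncated integral over [{x | eps <= |x - xi|}]. *)
Definition pv_integrand {V : NormedModule R_AbsRing}
    (g : R -> V) (xi eps x : R) : V :=
  if Rle_dec eps (Rabs (x - xi)) then scal (/ (x - xi)) (g x) else zero.

(** [l] is the Cauchy principal value of the integral of [g x / (x - xi)] over
    the real line: joint limit as [eps -> 0+] and [R -> +oo].  [filterlimi]
    also asserts that the truncated integrals eventually exist. *)
Definition is_PV {V : NormedModule R_AbsRing}
    (g : R -> V) (xi : R) (l : V) : Prop :=
  filterlimi
    (fun p : R * R => is_RInt (pv_integrand g xi (fst p)) (- snd p) (snd p))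
    (filter_prod (at_right 0) (Rbar_locally p_infty))
    (locally l).

(* Main.v *)
Require Import Defs.
From Stdlib Require Import Reals Lra ClassicalEpsilon.
From Coquelicot Require Import Coquelicot.
Open Scope R_scope.

(** Integrate [F z / (z - xi)] along the boundary of the lower half annulus
    [eps <= |z - xi| <= rho].  By Cauchy's theorem the integral vanishes; the two
    real segments give the symmetric truncation of the principal value, the
    small half circle tends to a multiple of [F xi] by continuity, and the large
    one tends to [0] because [F] does.  What remains of the truncation to
    [[-R, R]], which is centred at [0] and not at [xi], has bounded length and
    an integrand of size [o(1/R)].  The limit is [- PI * i * F xi], and the
    relations between [U] and [V] are its real and imaginary parts.

    Holomorphy is assumed in the form of pointwise differentiability, without
    continuity of the derivative, so Cauchy's theorem is needed in Goursat's
    version.  It is proved for real 1-forms: a form [p dx + q dy] whose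
    coefficients are differentiable at every point of a rectangle, with
    [dp/dy = dq/dx], has circulation [0] around it
    ([closed_form_circulation_zero]); the proof is Goursat's subdivision
    argument, extracted as [rectangle_bisection].  The half annulus is a
    rectangle in the polar coordinates [(r, t)] at [xi], where
    [dz / (z - xi) = dr / r + i dt]; for [F = f + i g] the real part of
    [F dz / (z - xi)] is [f dr / r - g dt], and the Cauchy-Riemann equations say
    that it is closed ([polar_form_closed]).  This yields [indented_contour] and
    then [is_PV_conjugate]: the principal value for [f] is [PI * g xi 0].  Both
    parts of [F] are covered by this one statement, since [V - i U = - i F] is
    holomorphic as well. *)

(** * Bisection of rectangles *)

Definition half (a b a' b' : R) : Prop :=
  (a' = a /\ b' = (a + b) / 2) \/ (a' = (a + b) / 2 /\ b' = b).

Lemma nested_halves (a b : nat -> R) :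
  a O <= b O ->
  (forall n, half (a n) (b n) (a (S n)) (b (S n))) ->
  (forall n, a O <= a n /\ a n <= b n /\ b n <= b O) /\
  (exists x, forall n, a n <= x <= b n) /\
  (forall delta, 0 < delta -> exists N, forall n, (N <= n)%nat -> b n - a n < delta).
Proof.
  intros H0 Hh.
  assert (Hle : forall n, a n <= b n).
  { induction n as [|n IH]; [exact H0|]. destruct (Hh n) as [[-> ->]|[-> ->]]; lra. }
  assert (Hmono : forall m n, a n <= a (m + n)%nat /\ b (m + n)%nat <= b n).
  { induction m as [|m IH]; intros n; simpl; [lra|].
    specialize (IH n). specialize (Hle (m + n)%nat).
    destruct (Hh (m + n)%nat) as [[-> ->]|[-> ->]]; lra. }
  assert (Hcross : forall m n, a m <= b n).
  { intros m n. destruct (Hmono m n) as [_ H1]. destruct (Hmono n m) as [H2 _].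
    rewrite (Nat.add_comm n m) in H2. specialize (Hle (m + n)%nat). lra. }
  assert (Hlen : forall n, b n - a n = (b O - a O) * (1 / 2) ^ n).
  { induction n as [|n IH]; simpl; [ring|].
    destruct (Hh n) as [[-> ->]|[-> ->]]; lra. }
  repeat split.
  - destruct (Hmono n O) as [H _]. now rewrite Nat.add_0_r in H.
  - apply Hle.
  - destruct (Hmono n O) as [_ H]. now rewrite Nat.add_0_r in H.
  - destruct (completeness (fun y => exists n, y = a n)) as [x [Hub Hlub]].
    + exists (b O). intros y [n ->]. apply Hcross.
    + now exists (a O), O.
    + exists x. intros n. split; [apply Hub; now exists n|].
      apply Hlub. intros y [m ->]. apply Hcross.
  - intros delta Hd.
    destruct (pow_lt_1_zero (1 / 2)) with (y := delta / (b O - a O + 1)) as [N HN].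
    + rewrite Rabs_pos_eq; lra.
    + apply Rdiv_lt_0_compat; lra.
    + exists N. intros n Hn. specialize (HN n Hn). rewrite Hlen.
      assert (Hp : 0 < (1 / 2) ^ n) by (apply pow_lt; lra).
      rewrite Rabs_pos_eq in HN by lra.
      apply Rmult_lt_compat_r with (r := b O - a O + 1) in HN; [|lra].
      unfold Rdiv in HN at 2. rewrite Rmult_assoc, Rinv_l, Rmult_1_r in HN by lra. nra.
Qed.

(** If the conclusion failed, one of the four quarters of each bad rectangle
    would be bad again; the bad rectangles so obtained shrink to a point, where
    the local hypothesis contradicts badness. *)
Lemma rectangle_bisection (P : R -> R -> R -> R -> Prop) (a0 b0 c0 d0 : R) :
  a0 <= b0 -> c0 <= d0 ->
  (forall a b c d, a0 <= a -> a <= b -> b <= b0 -> c0 <= c -> c <= d -> d <= d0 ->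
     (forall a' b' c' d', half a b a' b' -> half c d c' d' -> P a' b' c' d') ->
     P a b c d) ->
  (forall x y, a0 <= x <= b0 -> c0 <= y <= d0 ->
     exists delta, 0 < delta /\
     forall a b c d, a0 <= a -> b <= b0 -> c0 <= c -> d <= d0 ->
       a <= x <= b -> c <= y <= d -> b - a < delta -> d - c < delta -> P a b c d) ->
  P a0 b0 c0 d0.
Proof.
  intros Hab Hcd Hstep Hloc. apply NNPP. intros Hbad.
  set (inside := fun B : R * R * (R * R) =>
    let '((a, b), (c, d)) := B in
    (a0 <= a /\ a <= b /\ b <= b0) /\ (c0 <= c /\ c <= d /\ d <= d0)).
  set (bad := fun B : R * R * (R * R) => let '((a, b), (c, d)) := B in ~ P a b c d).
  set (quarter := fun B B' : R * R * (R * R) =>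
    half (fst (fst B)) (snd (fst B)) (fst (fst B')) (snd (fst B')) /\
    half (fst (snd B)) (snd (snd B)) (fst (snd B')) (snd (snd B'))).
  assert (Hex : forall B, exists B', quarter B B' /\ (inside B -> bad B -> bad B')).
  { intros [[a b] [c d]].
    destruct (classic (exists B', quarter ((a, b), (c, d)) B' /\ bad B')) as [[B' [H1 H2]]|Hno].
    - exists B'. tauto.
    - exists ((a, (a + b) / 2), (c, (c + d) / 2)). split.
      + split; left; split; reflexivity.
      + intros [[H1 [H2 H3]] [H4 [H5 H6]]] Hb. exfalso. apply Hb.
        apply Hstep; try assumption.
        intros a' b' c' d' Ha' Hc'. apply NNPP. intros HP. apply Hno.
        exists ((a', b'), (c', d')). split; [split; assumption|exact HP]. }
  set (next := fun B => proj1_sig (constructive_indefinite_description _ (Hex B))).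
  assert (Hnext : forall B, quarter B (next B) /\ (inside B -> bad B -> bad (next B))).
  { intros B. unfold next. now destruct (constructive_indefinite_description _ (Hex B)). }
  set (s := fun n => Nat.iter n next ((a0, b0), (c0, d0))).
  destruct (nested_halves (fun n => fst (fst (s n))) (fun n => snd (fst (s n))))
    as [Hin1 [[x Hx] Hs1]]; [exact Hab | intros n; apply (Hnext (s n)) |].
  destruct (nested_halves (fun n => fst (snd (s n))) (fun n => snd (snd (s n))))
    as [Hin2 [[y Hy] Hs2]]; [exact Hcd | intros n; apply (Hnext (s n)) |].
  assert (Hsbad : forall n, bad (s n)).
  { induction n as [|n IH]; [exact Hbad|]. apply (Hnext (s n)); [|exact IH].
    specialize (Hin1 n). specialize (Hin2 n).
    destruct (s n) as [[a b] [c d]]. exact (conj Hin1 Hin2). }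
  destruct (Hloc x y (Hx O) (Hy O)) as [delta [Hd HP]].
  destruct (Hs1 delta Hd) as [N1 HN1]. destruct (Hs2 delta Hd) as [N2 HN2].
  set (n := (N1 + N2)%nat).
  specialize (HN1 n (Nat.le_add_r _ _)).
  assert (Hn2 : (N2 <= n)%nat) by (unfold n; rewrite Nat.add_comm; apply Nat.le_add_r).
  specialize (HN2 n Hn2). specialize (Hsbad n).
  specialize (Hin1 n). specialize (Hin2 n). specialize (Hx n). specialize (Hy n).
  destruct (s n) as [[a b] [c d]]. simpl in *. apply Hsbad, HP; tauto.
Qed.

(** * Goursat's theorem for closed 1-forms *)

(** Line integral of [p dx + q dy] around the boundary of [[a, b] x [c, d]],
    counterclockwise.  Opposite sides are paired inside one integral because the
    difference of the integrand across the rectangle is what gets estimated. *)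
Definition circulation (p q : R -> R -> R) (a b c d : R) : R :=
  RInt (fun x => p x c - p x d) a b + RInt (fun y => q b y - q a y) c d.

(** Both coefficients are differentiable at the point and the two mixed partials
    share the value [k]. *)
Definition closed_at (p q : R -> R -> R) (x y : R) : Prop :=
  exists px k qy, differentiable_pt_lim p x y px k /\ differentiable_pt_lim q x y k qy.

Lemma differentiable_pt_lim_continuous_1 (f : R -> R -> R) (x y lx ly : R) :
  differentiable_pt_lim f x y lx ly -> continuous (fun t => f t y) x.
Proof.
  intros H. apply (ex_derive_continuous (fun t => f t y)). eexists.
  apply is_derive_Reals.
  apply (derivable_pt_lim_comp_2d f (fun t => t) (fun _ => y)); [exact H| |].
  - apply derivable_pt_lim_id.
  - apply derivable_pt_lim_const.
Qed.

Lemma differentiable_pt_lim_continuous_2 (f : R -> R -> R) (x y lx ly : R) :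
  differentiable_pt_lim f x y lx ly -> continuous (fun t => f x t) y.
Proof.
  intros H. apply (ex_derive_continuous (fun t => f x t)). eexists.
  apply is_derive_Reals.
  apply (derivable_pt_lim_comp_2d f (fun _ => x) (fun t => t)); [exact H| |].
  - apply derivable_pt_lim_const.
  - apply derivable_pt_lim_id.
Qed.

Lemma ex_RInt_minus_on (f g : R -> R) (a b : R) :
  a <= b ->
  (forall x, a <= x <= b -> continuous f x) ->
  (forall x, a <= x <= b -> continuous g x) ->
  ex_RInt (fun x => f x - g x) a b.
Proof.
  intros Hab Hf Hg.
  apply (ex_RInt_continuous (V := R_CompleteNormedModule)).
  rewrite Rmin_left, Rmax_right by assumption. intros z Hz.
  apply (continuous_minus (V := R_NormedModule)); [now apply Hf|now apply Hg].
Qed.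

(** The circulation is additive under subdivision, and near a point where the
    form is differentiable it is at most [2 eta (s + t)^2] on a rectangle of
    sides [s] and [t]: the linear parts contribute [- k s t] and [+ k s t].  The
    bound is chosen so that quartering preserves it, being homogeneous of degree
    2 in the sides; by bisection it holds for every [eta > 0] on the whole
    rectangle. *)
Lemma closed_form_circulation_zero (p q : R -> R -> R) (a0 b0 c0 d0 : R) :
  a0 <= b0 -> c0 <= d0 ->
  (forall x y, a0 <= x <= b0 -> c0 <= y <= d0 -> closed_at p q x y) ->
  circulation p q a0 b0 c0 d0 = 0.
Proof.
  intros Hab0 Hcd0 Hcl.
  assert (Ep : forall a b c d, a0 <= a -> a <= b -> b <= b0 -> c0 <= c <= d0 -> c0 <= d <= d0 ->
             ex_RInt (fun x => p x c - p x d) a b).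
  { intros a b c d ? ? ? ? ?.
    apply (ex_RInt_minus_on (fun x => p x c) (fun x => p x d)); [assumption| |]; intros x Hx.
    - destruct (Hcl x c) as (px & k & qy & HP & HQ); try lra.
      exact (differentiable_pt_lim_continuous_1 _ _ _ _ _ HP).
    - destruct (Hcl x d) as (px & k & qy & HP & HQ); try lra.
      exact (differentiable_pt_lim_continuous_1 _ _ _ _ _ HP). }
  assert (Eq : forall a b c d, c0 <= c -> c <= d -> d <= d0 -> a0 <= a <= b0 -> a0 <= b <= b0 ->
             ex_RInt (fun y => q b y - q a y) c d).
  { intros a b c d ? ? ? ? ?.
    apply (ex_RInt_minus_on (fun y => q b y) (fun y => q a y)); [assumption| |]; intros y Hy.
    - destruct (Hcl b y) as (px & k & qy & HP & HQ); try lra.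
      exact (differentiable_pt_lim_continuous_2 _ _ _ _ _ HQ).
    - destruct (Hcl a y) as (px & k & qy & HP & HQ); try lra.
      exact (differentiable_pt_lim_continuous_2 _ _ _ _ _ HQ). }
  assert (Hadd1 : forall a m b c d, a0 <= a -> a <= m -> m <= b -> b <= b0 ->
            c0 <= c -> c <= d -> d <= d0 ->
            circulation p q a b c d = circulation p q a m c d + circulation p q m b c d).
  { intros a m b c d ? ? ? ? ? ? ?. unfold circulation.
    rewrite <- (RInt_Chasles (fun x => p x c - p x d) a m b) by (apply Ep; lra).
    rewrite (RInt_ext (fun y => q b y - q a y) (fun y => plus (q m y - q a y) (q b y - q m y)))
      by (intros; unfold plus; simpl; ring).
    rewrite (RInt_plus (V := R_CompleteNormedModule)) by (apply Eq; lra).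
    unfold plus; simpl; ring. }
  assert (Hadd2 : forall a b c n d, a0 <= a -> a <= b -> b <= b0 ->
            c0 <= c -> c <= n -> n <= d -> d <= d0 ->
            circulation p q a b c d = circulation p q a b c n + circulation p q a b n d).
  { intros a b c n d ? ? ? ? ? ? ?. unfold circulation.
    rewrite <- (RInt_Chasles (fun y => q b y - q a y) c n d) by (apply Eq; lra).
    rewrite (RInt_ext (fun x => p x c - p x d) (fun x => plus (p x c - p x n) (p x n - p x d)))
      by (intros; unfold plus; simpl; ring).
    rewrite (RInt_plus (V := R_CompleteNormedModule)) by (apply Ep; lra).
    unfold plus; simpl; ring. }
  assert (Hbound : forall eta, 0 < eta ->
    Rabs (circulation p q a0 b0 c0 d0) <= 2 * eta * ((b0 - a0) + (d0 - c0)) ^ 2).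
  { intros eta Heta.
    apply (rectangle_bisection
      (fun a b c d => Rabs (circulation p q a b c d) <= 2 * eta * ((b - a) + (d - c)) ^ 2));
      try assumption.
    - intros a b c d ? ? ? ? ? ? Hq.
      set (m := (a + b) / 2). set (n := (c + d) / 2).
      assert (a <= m <= b) by (unfold m; lra). assert (c <= n <= d) by (unfold n; lra).
      rewrite (Hadd1 a m b c d), (Hadd2 a m c n d), (Hadd2 m b c n d) by lra.
      assert (Hl : half a b a m) by (left; split; reflexivity).
      assert (Hr : half a b m b) by (right; split; reflexivity).
      assert (Hd : half c d c n) by (left; split; reflexivity).
      assert (Hu : half c d n d) by (right; split; reflexivity).
      pose proof (Hq _ _ _ _ Hl Hd) as Q1. pose proof (Hq _ _ _ _ Hl Hu) as Q2.
      pose proof (Hq _ _ _ _ Hr Hd) as Q3. pose proof (Hq _ _ _ _ Hr Hu) as Q4.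
      replace (2 * eta * (b - a + (d - c)) ^ 2) with
        (2 * eta * (m - a + (n - c)) ^ 2 + 2 * eta * (m - a + (d - n)) ^ 2 +
         (2 * eta * (b - m + (n - c)) ^ 2 + 2 * eta * (b - m + (d - n)) ^ 2))
        by (unfold m, n; field).
      eapply Rle_trans; [apply Rabs_triang|].
      apply Rplus_le_compat; (eapply Rle_trans; [apply Rabs_triang|]);
        apply Rplus_le_compat; assumption.
    - intros x y Hx Hy.
      destruct (Hcl x y Hx Hy) as (px & k & qy & Hp & Hqq).
      destruct (Hp (mkposreal eta Heta)) as [d1 Hd1].
      destruct (Hqq (mkposreal eta Heta)) as [d2 Hd2].
      exists (Rmin d1 d2). split; [apply Rmin_pos; apply cond_pos|].
      intros a b c d Ha Hb Hc Hd Hxab Hycd Hs Ht.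
      pose proof (Rmin_l d1 d2) as Hm1. pose proof (Rmin_r d1 d2) as Hm2.
      set (s := b - a) in *. set (t := d - c) in *.
      assert (Bnd : forall (f : R -> R -> R) l1 l2 (dl : posreal), s < dl -> t < dl ->
        (forall u v, Rabs (u - x) < dl -> Rabs (v - y) < dl ->
          Rabs (f u v - f x y - (l1 * (u - x) + l2 * (v - y))) <=
           eta * Rmax (Rabs (u - x)) (Rabs (v - y))) ->
        forall u v, a <= u <= b -> c <= v <= d ->
          Rabs (f u v - f x y - (l1 * (u - x) + l2 * (v - y))) <= eta * (s + t)).
      { intros f l1 l2 dl Hsd Htd Hf u v Hu Hv.
        assert (Rabs (u - x) <= s) by (apply Rabs_le; unfold s; lra).
        assert (Rabs (v - y) <= t) by (apply Rabs_le; unfold t; lra).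
        eapply Rle_trans; [apply Hf; lra|].
        apply Rmult_le_compat_l; [lra|]. apply Rmax_lub; unfold s, t in *; lra. }
      assert (Bp := Bnd p px k d1 ltac:(lra) ltac:(lra) Hd1).
      assert (Bq := Bnd q k qy d2 ltac:(lra) ltac:(lra) Hd2).
      assert (Ip : Rabs (RInt (fun x => p x c - p x d) a b + k * (s * t)) <= s * (2 * (eta * (s + t)))).
      { assert (E : ex_RInt (fun x => p x c - p x d) a b) by (apply Ep; lra).
        replace (RInt (fun x => p x c - p x d) a b + k * (s * t))
          with (RInt (fun x => plus (p x c - p x d) (k * t)) a b).
        - apply (abs_RInt_le_const _ a b); [lra| |].
          + apply (ex_RInt_plus (V := R_NormedModule)); [exact E|apply ex_RInt_const].
          + intros u Hu. pose proof (Bp u c Hu ltac:(lra)) as B1.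
            pose proof (Bp u d Hu ltac:(lra)) as B2.
            replace (plus (p u c - p u d) (k * t)) with
              ((p u c - p x y - (px * (u - x) + k * (c - y))) -
               (p u d - p x y - (px * (u - x) + k * (d - y))))
              by (unfold plus, t; simpl; ring).
            eapply Rle_trans; [apply Rabs_triang|]. rewrite Rabs_Ropp. lra.
        - rewrite (RInt_plus (V := R_CompleteNormedModule)); [|exact E|apply ex_RInt_const].
          rewrite RInt_const. unfold plus, scal, s; simpl; unfold mult; simpl. ring. }
      assert (Iq : Rabs (RInt (fun y => q b y - q a y) c d - k * (s * t)) <= t * (2 * (eta * (s + t)))).
      { assert (E : ex_RInt (fun y => q b y - q a y) c d) by (apply Eq; lra).
        replace (RInt (fun y => q b y - q a y) c d - k * (s * t))
          with (RInt (fun y => plus (q b y - q a y) (- (k * s))) c d).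
        - apply (abs_RInt_le_const _ c d); [lra| |].
          + apply (ex_RInt_plus (V := R_NormedModule)); [exact E|apply ex_RInt_const].
          + intros v Hv. pose proof (Bq b v ltac:(lra) Hv) as B1.
            pose proof (Bq a v ltac:(lra) Hv) as B2.
            replace (plus (q b v - q a v) (- (k * s))) with
              ((q b v - q x y - (k * (b - x) + qy * (v - y))) -
               (q a v - q x y - (k * (a - x) + qy * (v - y))))
              by (unfold plus, s; simpl; ring).
            eapply Rle_trans; [apply Rabs_triang|]. rewrite Rabs_Ropp. lra.
        - rewrite (RInt_plus (V := R_CompleteNormedModule)); [|exact E|apply ex_RInt_const].
          rewrite RInt_const. unfold plus, scal, t; simpl; unfold mult; simpl. ring. }
      unfold circulation.
      replace (2 * eta * (s + t) ^ 2) with (s * (2 * (eta * (s + t))) + t * (2 * (eta * (s + t)))) by ring.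
      replace (RInt (fun x => p x c - p x d) a b + RInt (fun y => q b y - q a y) c d) with
        ((RInt (fun x => p x c - p x d) a b + k * (s * t)) +
         (RInt (fun y => q b y - q a y) c d - k * (s * t))) by ring.
      eapply Rle_trans; [apply Rabs_triang|]. lra. }
  set (L := 2 * ((b0 - a0) + (d0 - c0)) ^ 2) in *.
  assert (HL : 0 <= L) by (unfold L; nra).
  apply Rabs_eq_0. apply Rle_antisym; [|apply Rabs_pos].
  apply le_epsilon. intros e He.
  specialize (Hbound (e / (L + 1)) ltac:(apply Rdiv_lt_0_compat; lra)).
  eapply Rle_trans; [exact Hbound|].
  replace (2 * (e / (L + 1)) * (b0 - a0 + (d0 - c0)) ^ 2) with (e * (L / (L + 1)))
    by (unfold L; field; unfold L in HL; lra).
  rewrite Rplus_0_l. rewrite <- (Rmult_1_r e) at 2. apply Rmult_le_compat_l; [lra|].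
  apply Rmult_le_reg_r with (L + 1); [lra|]. unfold Rdiv. rewrite Rmult_assoc, Rinv_l by lra. lra.
Qed.

(** * Conjugate functions in polar coordinates *)

(** The Cauchy-Riemann equations for [f + i g], together with differentiability. *)
Definition conjugate_at (f g : R -> R -> R) (x y : R) : Prop :=
  exists lx ly, differentiable_pt_lim f x y lx ly /\ differentiable_pt_lim g x y (- ly) lx.

Lemma differentiable_pt_lim_eq (f : R -> R -> R) (x y lx ly lx' ly' : R) :
  differentiable_pt_lim f x y lx ly -> lx = lx' -> ly = ly' ->
  differentiable_pt_lim f x y lx' ly'.
Proof. now intros H <- <-. Qed.

Lemma differentiable_pt_lim_swap (f : R -> R -> R) (x y lx ly : R) :
  differentiable_pt_lim f x y lx ly ->
  differentiable_pt_lim (fun u v => f v u) y x ly lx.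
Proof.
  intros H eps. destruct (H eps) as [d Hd]. exists d. intros u v Hu Hv.
  rewrite Rmax_comm, (Rplus_comm (ly * _)). now apply Hd.
Qed.

Lemma differentiable_pt_lim_mul (x y : R) : differentiable_pt_lim Rmult x y y x.
Proof.
  intros eps. exists eps. intros u v _ Hv.
  replace (u * v - x * y - (y * (u - x) + x * (v - y))) with ((v - y) * (u - x)) by ring.
  rewrite Rabs_mult. apply Rmult_le_compat; [apply Rabs_pos|apply Rabs_pos|lra|apply Rmax_l].
Qed.

Lemma differentiable_pt_lim_prod (f g : R -> R -> R) (x y fx fy gx gy : R) :
  differentiable_pt_lim f x y fx fy -> differentiable_pt_lim g x y gx gy ->
  differentiable_pt_lim (fun u v => f u v * g u v) x y
    (g x y * fx + f x y * gx) (g x y * fy + f x y * gy).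
Proof.
  intros Hf Hg. apply (differentiable_pt_lim_comp Rmult); [|exact Hf|exact Hg].
  apply differentiable_pt_lim_mul.
Qed.

Lemma differentiable_pt_lim_comp1 (h : R -> R) (f : R -> R -> R) (x y l fx fy : R) :
  is_derive h (f x y) l -> differentiable_pt_lim f x y fx fy ->
  differentiable_pt_lim (fun u v => h (f u v)) x y (l * fx) (l * fy).
Proof.
  intros Hh Hf. apply is_derive_Reals in Hh.
  eapply differentiable_pt_lim_eq;
    [apply (differentiable_pt_lim_comp (fun u _ => h u) f f); [|exact Hf|exact Hf]| |].
  - apply differentiable_pt_lim_proj1_0, Hh.
  - ring.
  - ring.
Qed.

Lemma differentiable_pt_lim_fst (x y : R) : differentiable_pt_lim (fun u _ => u) x y 1 0.
Proof. apply (differentiable_pt_lim_proj1_0 (fun u => u)), derivable_pt_lim_id. Qed.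

Lemma differentiable_pt_lim_snd (x y : R) : differentiable_pt_lim (fun _ v => v) x y 0 1.
Proof. apply (differentiable_pt_lim_swap (fun u _ => u)), differentiable_pt_lim_fst. Qed.

Lemma differentiable_pt_lim_polar (f : R -> R -> R) (xi r t lx ly : R) :
  differentiable_pt_lim f (xi + r * cos t) (r * sin t) lx ly ->
  differentiable_pt_lim (fun r t => f (xi + r * cos t) (r * sin t)) r t
    (lx * cos t + ly * sin t) (r * (ly * cos t - lx * sin t)).
Proof.
  intros Hf.
  assert (Hc : differentiable_pt_lim (fun r t => xi + r * cos t) r t (cos t) (- (r * sin t))).
  { eapply differentiable_pt_lim_eq.
    - apply (differentiable_pt_lim_comp1 (fun z => xi + z) (fun r t => r * cos t)).
      + auto_derive; [exact I|reflexivity].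
      + apply (differentiable_pt_lim_prod (fun r _ => r) (fun _ t => cos t)).
        * apply differentiable_pt_lim_fst.
        * apply (differentiable_pt_lim_comp1 cos (fun _ t => t)).
          -- auto_derive; [exact I|reflexivity].
          -- apply differentiable_pt_lim_snd.
    - simpl. ring.
    - simpl. ring. }
  assert (Hs : differentiable_pt_lim (fun r t => r * sin t) r t (sin t) (r * cos t)).
  { eapply differentiable_pt_lim_eq.
    - apply (differentiable_pt_lim_prod (fun r _ => r) (fun _ t => sin t)).
      + apply differentiable_pt_lim_fst.
      + apply (differentiable_pt_lim_comp1 sin (fun _ t => t)).
        * auto_derive; [exact I|reflexivity].
        * apply differentiable_pt_lim_snd.
    - simpl. ring.
    - simpl. ring. }
  eapply differentiable_pt_lim_eq; [exact (differentiable_pt_lim_comp _ _ _ _ _ _ _ _ _ _ _ Hf Hc Hs)| |]; ring.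
Qed.

(** The form is the real part of [(f + i g) dz / (z - xi)]; both mixed partials
    equal [ly cos t - lx sin t], where [lx] and [ly] are the partials of [f]. *)
Lemma polar_form_closed (f g : R -> R -> R) (xi r t : R) :
  0 < r -> conjugate_at f g (xi + r * cos t) (r * sin t) ->
  closed_at (fun r t => / r * f (xi + r * cos t) (r * sin t))
            (fun r t => - g (xi + r * cos t) (r * sin t)) r t.
Proof.
  intros Hr (lx & ly & Hf & Hg).
  apply differentiable_pt_lim_polar in Hf. apply differentiable_pt_lim_polar in Hg.
  do 3 eexists. split.
  - apply (differentiable_pt_lim_prod (fun r _ => / r)); [|exact Hf].
    apply (differentiable_pt_lim_comp1 Rinv (fun r _ => r)); [|apply differentiable_pt_lim_fst].
    auto_derive; [lra|reflexivity].
  - eapply differentiable_pt_lim_eq;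
      [apply (differentiable_pt_lim_comp1 Ropp); [|exact Hg]; auto_derive; [exact I|reflexivity]| |].
    + field. lra.
    + reflexivity.
Qed.

(** * The indented contour *)

Definition arc_integral (g : R -> R -> R) (xi r : R) : R :=
  RInt (fun t => g (xi + r * cos t) (r * sin t)) (- PI) 0.

Definition cauchy_integrand (f : R -> R -> R) (xi x : R) : R := / (x - xi) * f x 0.

Lemma sin_nonpos (t : R) : - PI <= t <= 0 -> sin t <= 0.
Proof.
  intros Ht. pose proof (sin_ge_0 (- t) ltac:(lra) ltac:(lra)) as H.
  rewrite sin_neg in H. lra.
Qed.

Lemma arc_in_lower (r t : R) : 0 <= r -> - PI <= t <= 0 -> r * sin t <= 0.
Proof. intros Hr Ht. pose proof (sin_nonpos t Ht). nra. Qed.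

Definition vanishes_lower (h : R -> R -> R) : Prop :=
  forall eps, 0 < eps ->
  exists M, forall x y, y <= 0 -> M < Cmod (x, y) -> Rabs (h x y) < eps.

Lemma Cmod_polar (r t : R) : 0 <= r -> Cmod (r * cos t, r * sin t) = r.
Proof.
  intros Hr. unfold Cmod; simpl.
  replace (r * cos t * (r * cos t * 1) + r * sin t * (r * sin t * 1))
    with (r * r * (Rsqr (sin t) + Rsqr (cos t))) by (unfold Rsqr; ring).
  rewrite sin2_cos2, Rmult_1_r. now apply sqrt_square.
Qed.

Lemma Cmod_arc_ge (xi r t : R) : 0 <= r -> r - Rabs xi <= Cmod (xi + r * cos t, r * sin t).
Proof.
  intros Hr. pose proof (Cmod_triangle (xi + r * cos t, r * sin t) (RtoC (- xi))) as H.
  rewrite Cmod_R, Rabs_Ropp in H.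
  replace (Cplus (xi + r * cos t, r * sin t) (RtoC (- xi))) with (r * cos t, r * sin t) in H
    by (unfold Cplus, RtoC; simpl; f_equal; ring).
  rewrite Cmod_polar in H by exact Hr. lra.
Qed.

Section LowerHalfPlane.

Variables f g : R -> R -> R.
Hypothesis Hconj : forall x y, y <= 0 -> conjugate_at f g x y.

Lemma ex_RInt_arc xi r :
  0 <= r -> ex_RInt (fun t => g (xi + r * cos t) (r * sin t)) (- PI) 0.
Proof.
  intros Hr. pose proof PI_RGT_0.
  apply (ex_RInt_continuous (V := R_CompleteNormedModule)).
  rewrite Rmin_left, Rmax_right by lra. intros t Ht.
  destruct (Hconj (xi + r * cos t) (r * sin t) (arc_in_lower r t Hr Ht)) as (lx & ly & _ & Hg).
  apply differentiable_pt_lim_polar in Hg.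
  exact (differentiable_pt_lim_continuous_2 _ _ _ _ _ Hg).
Qed.

Lemma arc_integral_near xi r l delta :
  0 <= r ->
  (forall t, - PI <= t <= 0 -> Rabs (g (xi + r * cos t) (r * sin t) - l) <= delta) ->
  Rabs (arc_integral g xi r - PI * l) <= PI * delta.
Proof.
  intros Hr Hd. pose proof PI_RGT_0.
  pose proof (ex_RInt_arc xi r Hr) as E.
  replace (arc_integral g xi r - PI * l)
    with (RInt (fun t => minus (g (xi + r * cos t) (r * sin t)) l) (- PI) 0).
  - replace (PI * delta) with ((0 - - PI) * delta) by ring.
    apply abs_RInt_le_const; [lra| |exact Hd].
    apply (ex_RInt_minus (V := R_NormedModule)); [exact E|apply ex_RInt_const].
  - rewrite (RInt_minus (V := R_CompleteNormedModule)); [|exact E|apply ex_RInt_const].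
    rewrite RInt_const. unfold arc_integral, minus, plus, opp, scal; simpl. unfold mult; simpl. ring.
Qed.

Lemma continuous_cauchy_integrand xi x : x <> xi -> continuous (cauchy_integrand f xi) x.
Proof.
  intros Hx. apply (continuous_mult (K := R_AbsRing) (fun x => / (x - xi)) (fun x => f x 0)).
  - apply (ex_derive_continuous (fun x => / (x - xi))). auto_derive. lra.
  - destruct (Hconj x 0 (Rle_refl 0)) as (lx & ly & Hf & _).
    exact (differentiable_pt_lim_continuous_1 _ _ _ _ _ Hf).
Qed.

Lemma ex_RInt_cauchy_integrand xi a b :
  a <= b -> b < xi \/ xi < a -> ex_RInt (cauchy_integrand f xi) a b.
Proof.
  intros Hab Hxi. apply (ex_RInt_continuous (V := R_CompleteNormedModule)).
  rewrite Rmin_left, Rmax_right by lra. intros x Hx.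
  apply continuous_cauchy_integrand. lra.
Qed.

(** Vanishing of the circulation around [[eps, rho] x [-PI, 0]] in the [(r, t)]
    plane: the sides [t = - PI] and [t = 0] are the two real segments, the sides
    [r = eps] and [r = rho] the two half circles. *)
Lemma indented_contour xi eps rho :
  0 < eps <= rho ->
  RInt (cauchy_integrand f xi) (xi - rho) (xi - eps) +
  RInt (cauchy_integrand f xi) (xi + eps) (xi + rho) =
  arc_integral g xi eps - arc_integral g xi rho.
Proof.
  intros Hr. pose proof PI_RGT_0.
  pose proof (closed_form_circulation_zero
    (fun r t => / r * f (xi + r * cos t) (r * sin t))
    (fun r t => - g (xi + r * cos t) (r * sin t)) eps rho (- PI) 0) as H0.
  specialize (H0 ltac:(lra) ltac:(lra)).
  assert (H1 := H0 (fun r t Hr' Ht => polar_form_closed f g xi r t ltac:(lra)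
                  (Hconj _ _ (arc_in_lower r t ltac:(lra) Ht)))).
  clear H0. unfold circulation in H1.
  set (k := cauchy_integrand f xi) in *.
  assert (Eneg : ex_RInt k (-1 * eps + xi) (-1 * rho + xi)).
  { apply (ex_RInt_swap (V := R_NormedModule)). apply ex_RInt_cauchy_integrand; lra. }
  assert (Epos : ex_RInt k (1 * eps + xi) (1 * rho + xi))
    by (apply ex_RInt_cauchy_integrand; lra).
  (* The side [t = - PI] is [x = xi - r], the side [t = 0] is [x = xi + r]. *)
  rewrite (RInt_ext _ (fun r => minus (scal (-1) (k (-1 * r + xi))) (scal 1 (k (1 * r + xi))))) in H1.
  2: { intros r Hr'. rewrite Rmin_left in Hr' by lra. unfold k, cauchy_integrand.
       rewrite cos_neg, cos_PI, sin_neg, sin_PI, cos_0, sin_0.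
       replace (xi + r * -1) with (-1 * r + xi) by ring.
       replace (xi + r * 1) with (1 * r + xi) by ring.
       replace (r * - 0) with 0 by ring. rewrite Rmult_0_r.
       unfold minus, plus, opp, scal; simpl; unfold mult; simpl. field. lra. }
  rewrite (RInt_minus (V := R_CompleteNormedModule)) in H1;
    [|apply (ex_RInt_comp_lin (V := R_NormedModule) k); assumption|apply (ex_RInt_comp_lin (V := R_NormedModule) k); assumption].
  rewrite (RInt_comp_lin (V := R_CompleteNormedModule) k (-1) xi) in H1 by assumption.
  rewrite (RInt_comp_lin (V := R_CompleteNormedModule) k 1 xi) in H1 by assumption.
  rewrite (RInt_ext (fun t => - g (xi + rho * cos t) (rho * sin t) - - g (xi + eps * cos t) (eps * sin t))
             (fun t => minus (g (xi + eps * cos t) (eps * sin t)) (g (xi + rho * cos t) (rho * sin t)))) in H1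
    by (intros; unfold minus, plus, opp; simpl; ring).
  rewrite (RInt_minus (V := R_CompleteNormedModule)) in H1 by (apply ex_RInt_arc; lra).
  rewrite <- (opp_RInt_swap (V := R_CompleteNormedModule)) in H1
    by (apply ex_RInt_swap; assumption).
  replace (xi - rho) with (-1 * rho + xi) by ring.
  replace (xi - eps) with (-1 * eps + xi) by ring.
  replace (xi + eps) with (1 * eps + xi) by ring.
  replace (xi + rho) with (1 * rho + xi) by ring.
  unfold arc_integral. unfold minus, plus, opp in H1; simpl in H1. lra.
Qed.

Lemma is_RInt_pv_integrand xi eps Rad :
  0 < eps -> - Rad <= xi - eps -> xi + eps <= Rad ->
  is_RInt (V := R_NormedModule) (pv_integrand (V := R_NormedModule) (fun x => f x 0) xi eps) (- Rad) Rad
    (RInt (cauchy_integrand f xi) (- Rad) (xi - eps) + RInt (cauchy_integrand f xi) (xi + eps) Rad).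
Proof.
  intros He Hl Hr.
  replace (RInt (cauchy_integrand f xi) (- Rad) (xi - eps) + RInt (cauchy_integrand f xi) (xi + eps) Rad)
    with (plus (RInt (cauchy_integrand f xi) (- Rad) (xi - eps))
         (plus (scal ((xi + eps) - (xi - eps)) 0) (RInt (cauchy_integrand f xi) (xi + eps) Rad)))
    by (unfold plus, scal; simpl; unfold mult; simpl; ring).
  apply (is_RInt_Chasles (V := R_NormedModule) _ _ (xi - eps));
    [|apply (is_RInt_Chasles (V := R_NormedModule) _ _ (xi + eps))].
  - apply (is_RInt_ext (V := R_NormedModule) (cauchy_integrand f xi)).
    + rewrite Rmin_left, Rmax_right by lra. intros x Hx. unfold pv_integrand, cauchy_integrand.
      destruct (Rle_dec eps (Rabs (x - xi))) as [_|Hn]; [reflexivity|].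
      exfalso; apply Hn. rewrite Rabs_left1; lra.
    + apply (RInt_correct (V := R_CompleteNormedModule)), ex_RInt_cauchy_integrand; lra.
  - apply (is_RInt_ext (V := R_NormedModule) (fun _ => 0)).
    + rewrite Rmin_left, Rmax_right by lra. intros x Hx. unfold pv_integrand.
      destruct (Rle_dec eps (Rabs (x - xi))) as [Hy|_]; [|reflexivity].
      exfalso. apply (Rle_not_lt _ _ Hy). apply Rabs_def1; lra.
    + apply (is_RInt_const (V := R_NormedModule)).
  - apply (is_RInt_ext (V := R_NormedModule) (cauchy_integrand f xi)).
    + rewrite Rmin_left, Rmax_right by lra. intros x Hx. unfold pv_integrand, cauchy_integrand.
      destruct (Rle_dec eps (Rabs (x - xi))) as [_|Hn]; [reflexivity|].
      exfalso; apply Hn. rewrite Rabs_pos_eq; lra.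
    + apply (RInt_correct (V := R_CompleteNormedModule)), ex_RInt_cauchy_integrand; lra.
Qed.

Lemma cauchy_integrand_tail xi a b rho delta :
  a <= b -> 0 < rho -> b <= xi - rho \/ xi + rho <= a ->
  (forall x, a <= x <= b -> Rabs (f x 0) <= delta) ->
  Rabs (RInt (cauchy_integrand f xi) a b) <= (b - a) * (delta / rho).
Proof.
  intros Hab Hrho Hout Hd. apply abs_RInt_le_const; [exact Hab| |].
  - apply ex_RInt_cauchy_integrand; lra.
  - intros x Hx. unfold cauchy_integrand. rewrite Rabs_mult, Rmult_comm.
    assert (Hx' : rho <= Rabs (x - xi)).
    { destruct Hout; [rewrite Rabs_left1|rewrite Rabs_pos_eq]; lra. }
    apply Rmult_le_compat; [apply Rabs_pos|apply Rabs_pos|now apply Hd|].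
    rewrite Rabs_inv. apply Rinv_le_contravar; assumption.
Qed.

(** With [rho = Rad - |xi|] the symmetric interval of radius [rho] about [xi]
    lies in [[-Rad, Rad]] and leaves out tails of total length [2 |xi|].  The
    error is therefore at most [PI delta] for each half circle plus [delta] for
    the tails, which is below [10 delta]. *)
Lemma is_PV_conjugate xi :
  vanishes_lower f -> vanishes_lower g ->
  is_PV (V := R_NormedModule) (fun x => f x 0) xi (PI * g xi 0).
Proof.
  intros Vf Vg. unfold is_PV.
  apply (filterlimi_locally (F := filter_prod (at_right 0) (Rbar_locally p_infty))
           (U := R_UniformSpace)).
  intros e. set (delta := e / 10).
  assert (Hdelta : 0 < delta) by (unfold delta; pose proof (cond_pos e); lra).
  destruct (Vf delta Hdelta) as [Mf HMf]. destruct (Vg delta Hdelta) as [Mg HMg].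
  destruct (Hconj xi 0 (Rle_refl 0)) as (lx & ly & _ & Hg).
  assert (Hcont : continuity_2d_pt g xi 0).
  { apply differentiable_continuity_pt. now exists (- ly), lx. }
  destruct (Hcont (mkposreal delta Hdelta)) as [d Hd]. simpl in Hd.
  pose proof (Rabs_pos xi) as Hxi0. pose proof (RRle_abs xi) as Hxi1.
  pose proof (RRle_abs (- xi)) as Hxi2. rewrite Rabs_Ropp in Hxi2.
  apply (Filter_prod _ _ _ (fun eps => 0 < eps < Rmin d 1)
           (fun Rad => Rabs Mf + Rabs Mg + 3 * Rabs xi + 1 < Rad)).
  - assert (Hm : 0 < Rmin d 1) by (apply Rmin_pos; [apply cond_pos|lra]).
    exists (mkposreal _ Hm). intros eps Hb Hpos. split; [exact Hpos|].
    unfold ball in Hb; simpl in Hb. unfold AbsRing_ball, abs, minus, plus, opp in Hb; simpl in Hb.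
    rewrite Ropp_0, Rplus_0_r in Hb. apply Rabs_def2 in Hb. lra.
  - exists (Rabs Mf + Rabs Mg + 3 * Rabs xi + 1). tauto.
  - intros eps Rad [He0 He1] HR. simpl fst; simpl snd.
    pose proof (Rmin_l d 1) as Hm1. pose proof (Rmin_r d 1) as Hm2.
    pose proof (RRle_abs Mf) as HMf1. pose proof (RRle_abs Mg) as HMg1.
    pose proof (Rabs_pos Mf) as HMf0. pose proof (Rabs_pos Mg) as HMg0.
    eexists. split; [apply is_RInt_pv_integrand; lra|].
    set (rho := Rad - Rabs xi).
    assert (Hrho : rho > Rabs Mf + Rabs Mg + 2 * Rabs xi + 1) by (unfold rho; lra).
    set (k := cauchy_integrand f xi).
    assert (Hleft : plus (RInt k (- Rad) (xi - rho)) (RInt k (xi - rho) (xi - eps))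
                    = RInt k (- Rad) (xi - eps)).
    { apply (RInt_Chasles (V := R_CompleteNormedModule)); apply ex_RInt_cauchy_integrand; unfold rho in *; lra. }
    assert (Hright : plus (RInt k (xi + eps) (xi + rho)) (RInt k (xi + rho) Rad)
                    = RInt k (xi + eps) Rad).
    { apply (RInt_Chasles (V := R_CompleteNormedModule)); apply ex_RInt_cauchy_integrand; unfold rho in *; lra. }
    pose proof (indented_contour xi eps rho ltac:(lra)) as Hcontour. fold k in Hcontour.
    assert (Hsmall : Rabs (arc_integral g xi eps - PI * g xi 0) <= PI * delta).
    { apply arc_integral_near; [lra|]. intros t _. left.
      assert (Hct : Rabs (eps * cos t) <= eps).
      { rewrite Rabs_mult, (Rabs_pos_eq eps) by lra.
        pose proof (COS_bound t). assert (Rabs (cos t) <= 1) by (apply Rabs_le; lra). nra. }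
      assert (Hst : Rabs (eps * sin t) <= eps).
      { rewrite Rabs_mult, (Rabs_pos_eq eps) by lra.
        pose proof (SIN_bound t). assert (Rabs (sin t) <= 1) by (apply Rabs_le; lra). nra. }
      apply Hd.
      - replace (xi + eps * cos t - xi) with (eps * cos t) by ring. lra.
      - rewrite Rminus_0_r. lra. }
    assert (Hlarge : Rabs (arc_integral g xi rho - PI * 0) <= PI * delta).
    { apply arc_integral_near; [lra|]. intros t Ht. left. rewrite Rminus_0_r.
      apply HMg; [apply arc_in_lower; lra|].
      pose proof (Cmod_arc_ge xi rho t ltac:(lra)). lra. }
    rewrite Rmult_0_r, Rminus_0_r in Hlarge.
    assert (Htl : Rabs (RInt k (- Rad) (xi - rho)) <= ((xi - rho) - (- Rad)) * (delta / rho)).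
    { apply cauchy_integrand_tail; try (unfold rho in *; lra).
      intros x Hx. left. apply HMf; [lra|]. change (Mf < Cmod (RtoC x)). rewrite Cmod_R.
      rewrite Rabs_left1; lra. }
    assert (Htr : Rabs (RInt k (xi + rho) Rad) <= (Rad - (xi + rho)) * (delta / rho)).
    { apply cauchy_integrand_tail; try (unfold rho in *; lra).
      intros x Hx. left. apply HMf; [lra|]. change (Mf < Cmod (RtoC x)). rewrite Cmod_R.
      rewrite Rabs_pos_eq; lra. }
    assert (Hq : 2 * Rabs xi * (delta / rho) <= delta).
    { apply Rmult_le_reg_r with rho; [lra|].
      replace (2 * Rabs xi * (delta / rho) * rho) with (delta * (2 * Rabs xi)) by (field; lra).
      apply Rmult_le_compat_l; lra. }
    assert (Htot : ((xi - rho) - (- Rad)) * (delta / rho) + (Rad - (xi + rho)) * (delta / rho)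
                   <= delta) by (unfold rho at 1 3; lra).
    assert (HPI : PI * delta <= 4 * delta) by (pose proof PI_4; nra).
    unfold ball; simpl. unfold AbsRing_ball, abs, minus, opp; simpl.
    rewrite <- Hleft, <- Hright. unfold plus; simpl.
    apply Rabs_le_between in Hsmall, Hlarge, Htl, Htr.
    assert (He : pos e = 10 * delta) by (unfold delta; field).
    apply Rabs_def1; lra.
Qed.

End LowerHalfPlane.

(** * Holomorphic functions and principal values *)

Lemma polar_lower (x y : R) :
  y <= 0 -> 0 < Cmod (x, y) ->
  exists t, - PI <= t <= 0 /\ x = Cmod (x, y) * cos t /\ y = Cmod (x, y) * sin t.
Proof.
  intros Hy. set (r := Cmod (x, y)). intros Hr.
  assert (Hr2 : r * r = x * x + y * y).
  { unfold r, Cmod; simpl. rewrite sqrt_sqrt by nra. ring. }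
  assert (Hb : -1 <= x / r <= 1).
  { split; apply Rmult_le_reg_r with r; try exact Hr; unfold Rdiv;
      rewrite Rmult_assoc, Rinv_l by lra; nra. }
  exists (- acos (x / r)). pose proof (acos_bound (x / r)).
  rewrite cos_neg, sin_neg, cos_acos, sin_acos by exact Hb.
  split; [lra|split; [field; lra|]].
  replace (1 - Rsqr (x / r)) with (Rsqr (- y / r)).
  - rewrite sqrt_Rsqr; [field; lra|].
    apply Rmult_le_pos; [lra|]. left. now apply Rinv_0_lt_compat.
  - unfold Rsqr. field_simplify_eq; [|lra]. simpl. nra.
Qed.

Lemma vanishes_lower_bound (F : C -> C) (h : R -> R -> R) :
  vanishes_at_infinity_lower F ->
  (forall x y, Rabs (h x y) <= Cmod (F (x, y))) -> vanishes_lower h.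
Proof.
  intros HF Hh eps He. destruct (HF eps He) as [M HM].
  exists (Rmax M 0). intros x y Hy HMr.
  pose proof (Rmax_l M 0). pose proof (Rmax_r M 0).
  eapply Rle_lt_trans; [apply Hh|].
  destruct (polar_lower x y Hy ltac:(lra)) as (t & Ht & Hx & Hy').
  replace (x, y) with (Cmod (x, y) * cos t, Cmod (x, y) * sin t)
    by now rewrite <- Hx, <- Hy'.
  apply HM; lra.
Qed.

(** Complex differentiability measures increments by the modulus, real
    differentiability by the maximum norm; they differ by a factor of at most
    [sqrt 2], which [eps] and [delta] absorb. *)
Lemma is_derive_cauchy_riemann (F : C -> C) (x y : R) (l : C) :
  is_derive (K := C_AbsRing) (V := C_NormedModule) F (x, y) l ->
  differentiable_pt_lim (fun x y => fst (F (x, y))) x y (fst l) (- snd l) /\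
  differentiable_pt_lim (fun x y => snd (F (x, y))) x y (snd l) (fst l).
Proof.
  intros [_ Hd].
  assert (Hb : forall eps : posreal, locally_2d (fun u v =>
     Cmod (F (u, v) - F (x, y) - ((u, v) - (x, y)) * l)%C
       <= eps * Rmax (Rabs (u - x)) (Rabs (v - y))) x y).
  { intros eps.
    assert (Hs : 0 < sqrt 2) by (apply sqrt_lt_R0; lra).
    assert (He : 0 < eps / sqrt 2) by (apply Rdiv_lt_0_compat; [apply cond_pos|exact Hs]).
    specialize (Hd (x, y) (fun P HP => HP) (mkposreal _ He)).
    destruct Hd as [d Hd].
    assert (Hd2 : 0 < d / sqrt 2) by (apply Rdiv_lt_0_compat; [apply cond_pos|exact Hs]).
    exists (mkposreal _ Hd2). simpl. intros u v Hu Hv.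
    pose proof (Cmod_2Rmax ((u, v) - (x, y))%C) as Hm. simpl in Hm.
    fold (u - x) in Hm. fold (v - y) in Hm.
    assert (HM : Rmax (Rabs (u - x)) (Rabs (v - y)) < d / sqrt 2) by now apply Rmax_lub_lt.
    assert (Hball : Cmod ((u, v) - (x, y))%C < d).
    { eapply Rle_lt_trans; [exact Hm|].
      replace (pos d) with (sqrt 2 * (d / sqrt 2)) by (field; lra).
      now apply Rmult_lt_compat_l. }
    specialize (Hd (u, v) Hball).
    change (Cmod (F (u, v) - F (x, y) - ((u, v) - (x, y)) * l)%C
              <= eps / sqrt 2 * Cmod ((u, v) - (x, y))%C) in Hd.
    eapply Rle_trans; [exact Hd|].
    replace (eps * Rmax (Rabs (u - x)) (Rabs (v - y)))
      with (eps / sqrt 2 * (sqrt 2 * Rmax (Rabs (u - x)) (Rabs (v - y)))) by (field; lra).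
    apply Rmult_le_compat_l; [lra|exact Hm]. }
  split; intros eps; destruct (Hb eps) as [d Hd']; exists d; intros u v Hu Hv;
    (eapply Rle_trans; [|exact (Hd' u v Hu Hv)]);
    (eapply Rle_trans; [|apply Rmax_Cmod]).
  - eapply Rle_trans; [|apply Rmax_l]. right. f_equal. simpl. ring.
  - eapply Rle_trans; [|apply Rmax_r]. right. f_equal. simpl. ring.
Qed.

Lemma is_PV_pair (h : R -> C) (xi l1 l2 : R) :
  is_PV (V := R_NormedModule) (fun x => fst (h x)) xi l1 ->
  is_PV (V := R_NormedModule) (fun x => snd (h x)) xi l2 ->
  is_PV (V := C_R_NormedModule) h xi (l1, l2).
Proof.
  unfold is_PV. intros H1 H2.
  apply (filterlimi_locally (F := filter_prod (at_right 0) (Rbar_locally p_infty))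
           (U := C_UniformSpace)).
  intros e.
  pose proof (proj1 (filterlimi_locally (F := filter_prod (at_right 0) (Rbar_locally p_infty))
           (U := R_UniformSpace) _ _) H1 e) as E1.
  pose proof (proj1 (filterlimi_locally (F := filter_prod (at_right 0) (Rbar_locally p_infty))
           (U := R_UniformSpace) _ _) H2 e) as E2.
  pose proof (filter_and _ _ E1 E2) as E. revert E. apply filter_imp.
  intros [eps Rad] [[z1 [I1 B1]] [z2 [I2 B2]]].
  exists (z1, z2). split; [|split; assumption]. simpl in *.
  apply (is_RInt_fct_extend_pair (U := R_NormedModule) (V := R_NormedModule)).
  - eapply is_RInt_ext; [|exact I1]. intros x _. unfold pv_integrand. simpl.
    now destruct (Rle_dec eps (Rabs (x - xi))).
  - eapply is_RInt_ext; [|exact I2]. intros x _. unfold pv_integrand. simpl.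
    now destruct (Rle_dec eps (Rabs (x - xi))).
Qed.

Lemma is_PV_ext (h1 h2 : R -> R) (xi l : R) :
  (forall x, h1 x = h2 x) ->
  is_PV (V := R_NormedModule) h1 xi l -> is_PV (V := R_NormedModule) h2 xi l.
Proof.
  intros Hh. apply filterlimi_ext. intros [eps Rad] l'.
  split; apply is_RInt_ext; intros x _; unfold pv_integrand; now rewrite Hh.
Qed.

Theorem mainTheorem7
  (F : C -> C) (D : C -> Prop) (U V : R -> R)
  (D_open : open D)
  (D_lower : forall z : C, Im z <= 0 -> D z)
  (F_hol : holomorphic_on D F)
  (F_inf : vanishes_at_infinity_lower F)
  (F_UV : forall x : R, F (RtoC x) = (RtoC (U x) + Ci * RtoC (V x))%C) :
  (forall xi : R,
     filterlim F (within (fun z : C => Im z < 0) (locally (RtoC xi)))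
       (locally (F (RtoC xi))) /\
     exists I : C,
       is_PV (V := C_R_NormedModule) (fun x : R => F (RtoC x)) xi I /\
       F (RtoC xi) = (RtoC (-1) / (RtoC PI * Ci) * I)%C) /\
  (forall xi : R,
     exists I : R,
       is_PV (V := R_NormedModule) V xi I /\ U xi = -1 / PI * I) /\
  (forall x : R,
     exists I : R,
       is_PV (V := R_NormedModule) U x I /\ V x = 1 / PI * I).
Proof.
  set (u := fun x y => fst (F (x, y))). set (v := fun x y => snd (F (x, y))).
  set (u' := fun x y => - u x y).
  pose proof PI_RGT_0 as HPI.
  assert (Hder : forall x y, y <= 0 -> exists l,
     differentiable_pt_lim u x y (fst l) (- snd l) /\
     differentiable_pt_lim v x y (snd l) (fst l)).
  { intros x y Hy. destruct (F_hol (x, y) (D_lower (x, y) Hy)) as [l Hl].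
    exists l. now apply is_derive_cauchy_riemann. }
  assert (Huv : forall x y, y <= 0 -> conjugate_at u v x y).
  { intros x y Hy. destruct (Hder x y Hy) as (l & Hu & Hv).
    exists (fst l), (- snd l). split; [exact Hu|]. now rewrite Ropp_involutive. }
  assert (Hvu : forall x y, y <= 0 -> conjugate_at v u' x y).
  { intros x y Hy. destruct (Hder x y Hy) as (l & Hu & Hv).
    exists (snd l), (fst l). split; [exact Hv|].
    eapply differentiable_pt_lim_eq;
      [apply (differentiable_pt_lim_comp1 Ropp); [|exact Hu]; auto_derive; [exact I|reflexivity]| |];
      ring. }
  assert (Vu : vanishes_lower u).
  { apply (vanishes_lower_bound F); [exact F_inf|]. intros x y.
    eapply Rle_trans; [apply Rmax_l|apply Rmax_Cmod]. }
  assert (Vv : vanishes_lower v).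
  { apply (vanishes_lower_bound F); [exact F_inf|]. intros x y.
    eapply Rle_trans; [apply Rmax_r|apply Rmax_Cmod]. }
  assert (Vu' : vanishes_lower u').
  { intros eps He. destruct (Vu eps He) as [M HM]. exists M. intros x y Hy Hr.
    unfold u'. rewrite Rabs_Ropp. now apply HM. }
  assert (HU : forall x, u x 0 = U x).
  { intros x. unfold u. change (x, 0) with (RtoC x). rewrite F_UV. simpl. ring. }
  assert (HV : forall x, v x 0 = V x).
  { intros x. unfold v. change (x, 0) with (RtoC x). rewrite F_UV. simpl. ring. }
  assert (PVu : forall xi, is_PV (V := R_NormedModule) (fun x => u x 0) xi (PI * V xi)).
  { intros xi. rewrite <- HV. now apply is_PV_conjugate. }
  assert (PVv : forall xi, is_PV (V := R_NormedModule) (fun x => v x 0) xi (- PI * U xi)).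
  { intros xi. replace (- PI * U xi) with (PI * u' xi 0) by (unfold u'; rewrite HU; ring).
    now apply is_PV_conjugate. }
  split; [|split].
  - intros xi. split.
    + refine (filterlim_filter_le_1 F (filter_le_within _) _).
      assert (E : ex_derive (K := C_AbsRing) (V := C_NormedModule) F (RtoC xi))
        by (apply F_hol, D_lower; simpl; lra).
      apply ex_derive_continuous in E.
      (* [E] is about the neighbourhoods given by the modulus, the goal about those
         of the product topology. *)
      intros P HP. specialize (E P HP).
      apply locally_C. exact E.
    (* [(PI V, - PI U)] is [- PI i F xi]. *)
    + exists (PI * V xi, - PI * U xi). split.
      * apply is_PV_pair; [apply PVu|apply PVv].
      * rewrite F_UV.
        assert (HC : RtoC PI <> 0%C) by (intros E; apply RtoC_inj in E; lra).
        replace (PI * V xi, - PI * U xi)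
          with (RtoC PI * (- Ci) * (RtoC (U xi) + Ci * RtoC (V xi)))%C
          by (apply injective_projections; simpl; ring).
        replace (RtoC (-1)) with (- RtoC 1)%C by (apply injective_projections; simpl; ring).
        assert (HCi : Ci <> 0%C) by (intros E; apply (f_equal snd) in E; simpl in E; lra).
        field. now split.
  - intros xi. exists (- PI * U xi). split.
    + apply (is_PV_ext (fun x => v x 0)); [exact HV|apply PVv].
    + field. lra.
  - intros xi. exists (PI * V xi). split.
    + apply (is_PV_ext (fun x => u x 0)); [exact HU|apply PVu].
    + field. lra.
Qed.
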